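(* Let $p$ and $q$ be two binary distributions (distributions on a two-element set) and let $\epsilon>0$. Then $$n^*(p,q,\epsilon)\asymp\begin{cases}\dfrac{1}{\epsilon^2\, d_{\mathrm{TV}}^2(p,q)}, & \text{if } \epsilon\le 1,\\[2mm] \dfrac{1}{e^\epsilon\, d_{\mathrm{TV}}^2(p,q)}, & \text{if } e^\epsilon\in\left[e,\dfrac{d_{\mathrm h}^2(p,q)}{d_{\mathrm{TV}}^2(p,q)}\right],\\[2mm] \dfrac{1}{d_{\mathrm h}^2(p,q)}, & \text{if } e^\epsilon>\dfrac{d_{\mathrm h}^2(p,q)}{d_{\mathrm{TV}}^2(p,q)},\end{cases}$$ where the cases are read in order (the first applicable case is used).
   Context: $d_{\mathrm{TV}}(p,q)=\frac12\sum_i|p_i-q_i|$ and $d_{\mathrm h}^2(p,q)=\sum_i(\sqrt{p_i}-\sqrt{q_i})^2$. The notation $a\asymp b$ means $c_1 b\le a\le c_2 b$ for universal positive constants $c_1,c_2$. A channel $\mathbf T$ from $\mathcal X$ to a countable set $\mathcal Y$ is a transition kernel $\mathbf T(y,x)=\mathbb P(Y=y\mid X=x)$, also viewed as a stochastic map $Y=\mathbf T(X)$. It is $\epsilon$-LDP if $\mathbf T(y,x)\le e^\epsilon\,\mathbf T(y,x')$ for all $x,x'\in\mathcal X$, $y\in\mathcal Y$. Sample complexity $n^*(p,q,\epsilon)$: the smallest $n$ for which there exist a deterministic rule assigning to each user $i\in[n]$ an $\epsilon$-LDP channel $\mathbf T_i$ from $\mathcal X$ to $\mathbb N$, and a test $\phi$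 with values in $\{p,q\}$, such that, when $X_1,\dots,X_n$ are i.i.d. and $Y_i=\mathbf T_i(X_i)$ are generated independently, $$\mathbb P_{(X_1,\dots,X_n)\sim p^{\otimes n}}(\phi(Y_1,\dots,Y_n)\ne p)+\mathbb P_{(X_1,\dots,X_n)\sim q^{\otimes n}}(\phi(Y_1,\dots,Y_n)\ne q)\le 0.1.$$ *)

(* Defs.v *)
From HB Require Import structures.
From mathcomp Require Import all_boot all_order all_algebra.
From mathcomp Require Import all_classical all_reals all_analysis.

Set Implicit Arguments.
Unset Strict Implicit.
Unset Printing Implicit Defensive.

Import Order.TTheory GRing.Theory Num.Theory.

Local Open Scope classical_set_scope.
Local Open Scope ring_scope.

Section Definitions.
Variable R : realType.

Definition is_distribution (X : finType) (p : X -> R) : Prop :=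
  (forall x, 0 <= p x) /\ \sum_x p x = 1.

Definition dTV (X : finType) (p q : X -> R) : R :=
  2^-1 * \sum_x `|p x - q x|.

(* The squared Hellinger distance, without a factor 1/2. *)
Definition dh2 (X : finType) (p q : X -> R) : R :=
  \sum_x (Num.sqrt (p x) - Num.sqrt (q x)) ^+ 2.

(* [T y x] is the probability of the output [y] given the input [x]. *)
Definition is_channel (X : finType) (Y : countType) (T : Y -> X -> R) : Prop :=
  forall x, (forall y, 0 <= T y x) /\
            (\esum_(y in [set: Y]) (T y x)%:E = 1)%E.

Definition is_LDP (X : finType) (Y : countType) (eps : R)
    (T : Y -> X -> R) : Prop :=
  forall (x x' : X) (y : Y), T y x <= expR eps * T y x'.

(* Probability that (Y_1, ..., Y_n) = y, where X_1, ..., X_n are i.i.d. with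
   law p and, given these, the Y_i are independent with Y_i ~ T_i(., X_i). *)
Definition output_pmf (X : finType) (n : nat) (p : X -> R)
    (T : 'I_n -> nat -> X -> R) (y : {ffun 'I_n -> nat}) : R :=
  \sum_(x : {ffun 'I_n -> X})
    (\prod_(i < n) p (x i)) * (\prod_(i < n) T i (y i) (x i)).

Definition output_prob (X : finType) (n : nat) (p : X -> R)
    (T : 'I_n -> nat -> X -> R) (A : set {ffun 'I_n -> nat}) : \bar R :=
  (\esum_(y in A) (output_pmf p T y)%:E)%E.

(* A test is boolean valued: [true] is the answer "p", [false] is "q". *)
Definition testable (X : finType) (p q : X -> R) (eps : R) (n : nat) : Prop :=
  exists (T : 'I_n -> nat -> X -> R) (phi : {ffun 'I_n -> nat} -> bool),
    (forall i, is_channel (T i) /\ is_LDP eps (T i)) /\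
    (output_prob p T [set y | phi y != true] +
     output_prob q T [set y | phi y != false] <= (1 / 10)%:E)%E.

(* An infimum of natural numbers, hence attained as soon as it is finite;
   it is +oo exactly when no sample size is sufficient. *)
Definition sample_complexity (X : finType) (p q : X -> R) (eps : R) : \bar R :=
  ereal_inf [set (n%:R : R)%:E | n in [set n : nat | testable p q eps n]].

(* The division of extended reals satisfies 1 / 0 = +oo, which is the value
   when p = q. The last case is dh2 / dTV^2 < e^eps, because eps > 1 there. *)
Definition sample_rate (X : finType) (p q : X -> R) (eps : R) : \bar R :=
  (if (eps <= 1)%R then 1 / (eps ^+ 2 * dTV p q ^+ 2)%R%:E
   else if (expR 1 <= expR eps <= dh2 p q / dTV p q ^+ 2)%R
   then 1 / (expR eps * dTV p q ^+ 2)%R%:E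
   else 1 / (dh2 p q)%:E)%E.

End Definitions.

(* Main.v *)
Require Import Defs.
From mathcomp Require Import all_boot all_order all_algebra.
From mathcomp Require Import all_classical all_reals all_analysis.
From mathcomp Require Import ring lra.

(* On a two-point set every [eps]-LDP channel is a post-processing of
   randomized response, so [n*] is, up to constants, the number of samples
   needed to distinguish the randomized responses to [p] and [q] themselves,
   namely the inverse of their squared Hellinger distance [H]: Le Cam's bound
   shows that [n H] must be bounded below, and the likelihood-ratio test has
   error at most [(1 - H / 2) ^ n]. For binary distributions with
   [s = p a + q a] one has [dh2 ~ dTV ^ 2 / (s (2 - s))]; randomized response
   multiplies [dTV] by [r = (E - 1) / (E + 1)], where [E = e ^ eps], and turns
   [u = s (2 - s)] into [1 - r ^ 2 + r ^ 2 u]. Hence [n*] is of order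
   [(4 E / (E - 1) ^ 2 + u) / dTV ^ 2], and the three regimes tell which
   summand dominates. *)

Set Implicit Arguments.
Unset Strict Implicit.
Unset Printing Implicit Defensive.

Import Order.TTheory GRing.Theory Num.Theory.
Import numFieldNormedType.Exports.

Local Open Scope classical_set_scope.
Local Open Scope ring_scope.

(** * Sums of product functions over sequences of naturals *)

Section EsumProd.
Variable R : realType.

Lemma esum_finType (T : finType) (a : T -> \bar R) :
  (forall x, 0 <= a x)%E -> (\esum_(x in [set: T]) a x = \sum_x a x)%E.
Proof.
move=> a0; rewrite esum_fset//; last exact: finite_finset.
rewrite (fsbig_seq _ _ (index_enum_uniq T)).
congr (\sum_(x \in _) a x)%E; apply/seteqP; split => x //= _.
exact: mem_index_enum.
Qed.

Lemma subset_le_esum (T : choiceType) (A B : set T) (a : T -> \bar R) :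
  (forall x, 0 <= a x)%E -> A `<=` B ->
  (\esum_(x in A) a x <= \esum_(x in B) a x)%E.
Proof.
move=> a0 AB; rewrite esum_mkcond [leRHS]esum_mkcond; apply: le_esum => x _.
case: (boolP (x \in A)) => [/set_mem/AB/mem_set -> //|_].
by case: ifP.
Qed.

Lemma prod_big_cvg (n : nat) (f : 'I_n -> nat -> R) (s : 'I_n -> R) :
  (forall i, f i @ \oo --> s i) ->
  (\prod_(i < n) f i N) @[N --> \oo] --> \prod_(i < n) s i.
Proof.
move=> fs; apply: cvg_big => //.
move=> x; exact: mul_continuous.
Qed.

Lemma esum_box (n N : nat) (f : 'I_n -> nat -> R) :
  (forall i k, 0 <= f i k) ->
  (\esum_(y in [set y : {ffun 'I_n -> nat} | forall i, (y i < N)%N])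
     (\prod_(i < n) f i (y i))%:E = (\prod_(i < n) \sum_(k < N) f i k)%:E)%E.
Proof.
move=> f0; pose e (w : {ffun 'I_n -> 'I_N}) := [ffun i => w i : nat].
rewrite (reindex_esum setT _ e); last first.
  split=> [w _ i|w w' _ _ ww'|y yN].
  - by rewrite ffunE.
  - apply/ffunP => i; apply/val_inj.
    by have := congr1 (fun y : {ffun 'I_n -> nat} => y i) ww'; rewrite !ffunE.
  - exists [ffun i => Ordinal (yN i)] => //.
    by apply/ffunP => i; rewrite !ffunE.
rewrite esum_finType => [|w]; last by rewrite lee_fin prodr_ge0.
rewrite sumEFin bigA_distr_bigA; congr (_%:E); apply: eq_bigr => w _.
by apply: eq_bigr => i _; rewrite ffunE.
Qed.

(** Every finite set of sequences lies in a box [y i < N], on which distributivity factors the sum;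
    the box sums converge to the product as [N] grows. *)
Lemma esum_prod (n : nat) (f : 'I_n -> nat -> R) (s : 'I_n -> R) :
  (forall i k, 0 <= f i k) ->
  (forall i, \esum_(k in [set: nat]) (f i k)%:E = (s i)%:E)%E ->
  (\esum_(y in [set: {ffun 'I_n -> nat}]) (\prod_(i < n) f i (y i))%:E
     = (\prod_(i < n) s i)%:E)%E.
Proof.
move=> f0 fs.
have F0 (y : {ffun 'I_n -> nat}) : (0 <= (\prod_(i < n) f i (y i))%:E)%E.
  by rewrite lee_fin prodr_ge0.
have sE i : (\sum_(k <oo) (f i k)%:E = (s i)%:E)%E.
  by rewrite nneseries_esumT// => k; rewrite lee_fin.
have partial_le i N : \sum_(k < N) f i k <= s i.
  rewrite -lee_fin -sE -sumEFin -(big_mkord xpredT (fun k => (f i k)%:E)).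
  by apply: nneseries_lim_ge => k _ _; rewrite lee_fin.
have partial_cvg i : (\sum_(k < N) f i k) @[N --> \oo] --> s i.
  have : cvgn (fun N => \sum_(0 <= k < N) (f i k)%:E)%E.
    by apply: is_cvg_nneseries => k _ _; rewrite lee_fin.
  move=> /cvg_ex[l fl]; move: (fl) => /cvg_lim -/(_ (@ereal_hausdorff R)) => El.
  move: fl; rewrite -El sE => /fine_cvgP[_].
  apply: cvg_trans; apply: near_eq_cvg; near=> N.
  by rewrite /= sumEFin big_mkord.
apply/eqP; rewrite eq_le; apply/andP; split.
  apply: ge_ereal_sup => _ [X [finX _] <-].
  rewrite -esum_fset//.
  have [l Xl] := (finite_seqP X).1 finX.
  pose N := (\max_(y <- l) \max_(i < n) y i).+1.
  apply: (@le_trans _ _ (\prod_(i < n) \sum_(k < N) f i k)%:E).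
    rewrite -esum_box//; apply: subset_le_esum => // y; rewrite Xl /= => yl i.
    rewrite ltnS (leq_trans (leq_bigmax i))//.
    exact: (@leq_bigmax_seq _ _ xpredT
      (fun y : {ffun 'I_n -> nat} => \max_(i < n) y i)).
  by rewrite lee_fin ler_prod// => i _; rewrite partial_le sumr_ge0.
apply: (@cvge_to_le _ \oo _ _
  (fun N => (\prod_(i < n) \sum_(k < N) f i k)%:E)).
  apply: cvg_EFin; first exact: nearW.
  exact: prod_big_cvg.
apply: nearW => N; rewrite -esum_box//.
exact: subset_le_esum.
Unshelve. all: end_near. Qed.
End EsumProd.

(** * Hellinger bounds on the error of tests *)

Section Testing.
Variable R : realType.

Lemma esumZl (T : choiceType) (A : set T) (c : R) (f : T -> R) : 0 <= c ->
  (\esum_(x in A) (c * f x)%:E = c%:E * \esum_(x in A) (f x)%:E)%E.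
Proof.
have leZ (k : R) (g : T -> R) : 0 <= k ->
    (\esum_(x in A) (k * g x)%:E <= k%:E * \esum_(x in A) (g x)%:E)%E.
  move=> k0; apply: ge_ereal_sup => _ [F [finF FA] <-].
  have -> : (\sum_(x \in F) (k * g x)%:E = k%:E * \sum_(x \in F) (g x)%:E)%E.
    by rewrite !fsbig_finite//= !sumEFin -EFinM mulr_sumr.
  by rewrite lee_wpmul2l// ereal_sup_ubound//; exists F.
rewrite le_eqVlt => /predU1P[<-|c0].
  by rewrite mul0e esum1// => x _; rewrite mul0r.
apply/eqP; rewrite eq_le leZ/=; last exact: ltW.
(* The reverse inequality is [leZ] for the factor [c^-1] and the function [c * f]. *)
rewrite -lee_pdivlMl// (le_trans _ (leZ _ _ _)) ?invr_ge0 ?(ltW c0)//.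
by apply: le_esum => x _; rewrite mulKf ?gt_eqF.
Qed.

Lemma onem_expr_ge (x : R) (n : nat) :
  0 <= x <= 1 -> 1 - n%:R * x <= (1 - x) ^+ n.
Proof.
move=> /andP[x0 x1]; elim: n => [|n IH]; first by rewrite mul0r subr0 expr0.
have n0 : 0 <= n%:R :> R by [].
rewrite exprS (le_trans _ (ler_wpM2l _ IH)) ?subr_ge0// -natr1; nra.
Qed.

(** A rational substitute for [(1 - x) ^ n <= exp (- n x)]; the induction step is
    [(1 - x) (1 + (n + 1) x) <= 1 + n x]. *)
Lemma onem_expr_le (x : R) (n : nat) :
  0 <= x <= 1 -> (1 - x) ^+ n * (1 + n%:R * x) <= 1.
Proof.
move=> /andP[x0 x1]; elim: n => [|n IH].
  by rewrite mul0r addr0 expr0 mulr1.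
apply: le_trans IH; rewrite exprSr -mulrA ler_wpM2l ?exprn_ge0 ?subr_ge0//.
have n0 : 0 <= n%:R :> R by [].
rewrite -natr1; nra.
Qed.

Section Distributions.
Variable X : finType.
Implicit Types p q : X -> R.

(** The left-hand side is the Bhattacharyya coefficient, which, unlike [dh2], is multiplicative over
    product laws. *)
Lemma sum_sqrt_dh2 p q : is_distribution p -> is_distribution q ->
  \sum_x Num.sqrt (p x * q x) = 1 - dh2 p q / 2.
Proof.
move=> [p0 p1] [q0 q1]; rewrite /dh2.
under [in RHS]eq_bigr => x _.
  rewrite sqrrB !sqr_sqrtr// -sqrtrM// addrAC; over.
rewrite sumrB big_split/= p1 q1 sumrMnl; by field.
Qed.

Lemma dh2_ge0 p q : 0 <= dh2 p q.
Proof. by apply: sumr_ge0 => x _; exact: sqr_ge0. Qed.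

Lemma dh2_half_itv p q : is_distribution p -> is_distribution q ->
  0 <= dh2 p q / 2 <= 1.
Proof.
move=> hp hq; rewrite divr_ge0 ?dh2_ge0//= -subr_ge0 -sum_sqrt_dh2//.
by apply: sumr_ge0 => x _; exact: sqrtr_ge0.
Qed.

Lemma sqrt_prod (n : nat) (f : 'I_n -> R) : (forall i, 0 <= f i) ->
  Num.sqrt (\prod_(i < n) f i) = \prod_(i < n) Num.sqrt (f i).
Proof.
elim: n f => [|n IH] f f0; first by rewrite !big_ord0 sqrtr1.
by rewrite !big_ord_recl sqrtrM// IH.
Qed.

Lemma sum_prod_ffun (n : nat) (f : X -> R) :
  \sum_(z : {ffun 'I_n -> X}) \prod_(i < n) f (z i) = (\sum_x f x) ^+ n.
Proof.
by rewrite -(bigA_distr_bigA (fun _ x => f x)) prodr_const card_ord.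
Qed.

(* Summed over the sample space with [c] the Bhattacharyya coefficient of the
   product laws, this is Le Cam's bound [c ^ 2 / 2 <= \sum min]. *)
Lemma ge_min_sqrt (c x y : R) : 0 <= x -> 0 <= y ->
  c * Num.sqrt (x * y) - c ^+ 2 / 4 * (x + y) <= Num.min x y.
Proof.
move=> x0 y0; rewrite sqrtrM//.
rewrite -{2 3}(sqr_sqrtr x0) -{2 3}(sqr_sqrtr y0).
have := sqrtr_ge0 x; have := sqrtr_ge0 y.
move: (Num.sqrt x) (Num.sqrt y) => s t s0 t0.
rewrite le_min; apply/andP; split; rewrite -subr_ge0.
- have -> : s ^+ 2 - (c * (s * t) - c ^+ 2 / 4 * (s ^+ 2 + t ^+ 2)) =
    (s - c * t / 2) ^+ 2 + (c * s / 2) ^+ 2 by field.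
  by rewrite addr_ge0 ?sqr_ge0.
- have -> : t ^+ 2 - (c * (s * t) - c ^+ 2 / 4 * (s ^+ 2 + t ^+ 2)) =
    (t - c * s / 2) ^+ 2 + (c * t / 2) ^+ 2 by field.
  by rewrite addr_ge0 ?sqr_ge0.
Qed.

Lemma sum_min_ge p q (n : nat) : is_distribution p -> is_distribution q ->
  (1 - dh2 p q / 2) ^+ (n.*2) / 2 <=
  \sum_(z : {ffun 'I_n -> X})
    Num.min (\prod_(i < n) p (z i)) (\prod_(i < n) q (z i)).
Proof.
move=> hp hq; have [p0 p1] := hp; have [q0 q1] := hq.
pose c := (1 - dh2 p q / 2) ^+ n.
apply: (@le_trans _ _ (\sum_(z : {ffun 'I_n -> X})
  (c * Num.sqrt (\prod_(i < n) p (z i) * \prod_(i < n) q (z i)) -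
   c ^+ 2 / 4 * (\prod_(i < n) p (z i) + \prod_(i < n) q (z i))))).
  rewrite sumrB -!mulr_sumr big_split/= !sum_prod_ffun p1 q1 !expr1n.
  under [X in _ <= _ * X - _]eq_bigr => z _.
    rewrite -big_split/= sqrt_prod; last by move=> i; rewrite mulr_ge0.
    over.
  rewrite (sum_prod_ffun n (fun x => Num.sqrt (p x * q x))) sum_sqrt_dh2//.
  by rewrite -/c -muln2 exprM -/c; lra.
by apply: ler_sum => z _; apply: ge_min_sqrt; apply: prodr_ge0.
Qed.

Lemma output_pmfE (n : nat) p (T : 'I_n -> nat -> X -> R) y :
  output_pmf p T y = \prod_(i < n) \sum_x p x * T i (y i) x.
Proof.
rewrite bigA_distr_bigA /output_pmf; apply: eq_bigr => z _.
by rewrite -big_split.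
Qed.

Lemma output_pmf_ge0 (n : nat) p (T : 'I_n -> nat -> X -> R) y :
  is_distribution p -> (forall i, is_channel (T i)) -> 0 <= output_pmf p T y.
Proof.
move=> [p0 _] hT; rewrite output_pmfE prodr_ge0// => i _.
by rewrite sumr_ge0// => x _; rewrite mulr_ge0//; case: (hT i x).
Qed.

Lemma wrong_setC (n : nat) (phi : {ffun 'I_n -> nat} -> bool) :
  [set y | phi y != false] = ~` [set y | phi y != true].
Proof. by apply/seteqP; split => y /=; case: (phi y) => //= /(_ isT). Qed.

(** Data processing: [M] is the minimum of the two input laws pushed through the channels. It keeps
    its total mass and lies below both output laws, one of which counts as error at each output. *)
Lemma error_ge (n : nat) p q (T : 'I_n -> nat -> X -> R) phi :
  is_distribution p -> is_distribution q -> (forall i, is_channel (T i)) ->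
  ((\sum_(z : {ffun 'I_n -> X})
      Num.min (\prod_(i < n) p (z i)) (\prod_(i < n) q (z i)))%:E <=
   output_prob p T [set y | phi y != true] +
   output_prob q T [set y | phi y != false])%E.
Proof.
move=> hp hq hT; have [p0 _] := hp; have [q0 _] := hq.
pose m (z : {ffun 'I_n -> X}) :=
  Num.min (\prod_(i < n) p (z i)) (\prod_(i < n) q (z i)).
have m0 z : 0 <= m z by rewrite le_min !prodr_ge0.
pose k (z : {ffun 'I_n -> X}) (y : {ffun 'I_n -> nat}) :=
  \prod_(i < n) T i (y i) (z i).
have k0 z y : 0 <= k z y by rewrite prodr_ge0// => i _; case: (hT i (z i)).
pose M y := \sum_z m z * k z y.
have M0 y : 0 <= M y by rewrite sumr_ge0// => z _; rewrite mulr_ge0.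
apply: (@le_trans _ _ (\esum_(y in [set: {ffun 'I_n -> nat}]) (M y)%:E)%E).
  under eq_esum do rewrite /M -sumEFin.
  rewrite esum_sum; last by move=> y z _ _; rewrite lee_fin mulr_ge0.
  rewrite -sumEFin; apply: lee_sum => z _.
  rewrite esumZl// (@esum_prod _ _ (fun i j => T i j (z i)) (fun=> 1)).
  - by rewrite big1_eq mule1.
  - by move=> i j; case: (hT i (z i)).
  - by move=> i; case: (hT i (z i)).
rewrite (esumID [set y | phi y != true]) => [|y _]; last by rewrite lee_fin.
rewrite !setTI wrong_setC; apply: leeD; apply: le_esum => y _;
  rewrite lee_fin; apply: ler_sum => z _; rewrite ler_wpM2r ?k0//.
- by rewrite ge_min lexx.
- by rewrite ge_min lexx orbT.
Qed.

Lemma error_le_dh2 (n : nat) p q (T : 'I_n -> nat -> X -> R) phi :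
  is_distribution p -> is_distribution q -> (forall i, is_channel (T i)) ->
  (output_prob p T [set y | phi y != true] +
   output_prob q T [set y | phi y != false] <= (1 / 10)%:E)%E ->
  8 / 10 <= n%:R * dh2 p q.
Proof.
move=> hp hq hT /(le_trans (error_ge phi hp hq hT)); rewrite lee_fin.
move=> /(le_trans (sum_min_ge n hp hq)).
(* With [h = dh2 p q], the bound [(1 - h / 2) ^ (2 n) <= 1/5] becomes [1 - n h <= 1/5] by
   Bernoulli's inequality. *)
have := onem_expr_ge n.*2 (dh2_half_itv hp hq).
rewrite -muln2 natrM; lra.
Qed.

(** Here [c] is the Bhattacharyya coefficient of a single output. The maximum-likelihood test has as
    total error the sum of [min P Q], and the larger [sqrt (P Q)] factors over the users. *)
Lemma ml_error_le (n : nat) p q (T : nat -> X -> R) (c : R) :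
  is_distribution p -> is_distribution q -> is_channel T ->
  (\esum_(k in [set: nat])
     (Num.sqrt ((\sum_x p x * T k x) * (\sum_x q x * T k x)))%:E = c%:E)%E ->
  exists phi : {ffun 'I_n -> nat} -> bool,
  (output_prob p (fun=> T) [set y | phi y != true] +
   output_prob q (fun=> T) [set y | phi y != false] <= (c ^+ n)%:E)%E.
Proof.
move=> hp hq hT hc.
pose P := output_pmf p (fun _ : 'I_n => T).
pose Q := output_pmf q (fun _ : 'I_n => T).
have P0 y : 0 <= P y by exact: output_pmf_ge0.
have Q0 y : 0 <= Q y by exact: output_pmf_ge0.
exists (fun y => Q y <= P y).
have minE : (\esum_(y in [set: {ffun 'I_n -> nat}]) (Num.sqrt (P y * Q y))%:E
    = (c ^+ n)%:E)%E.
  rewrite -[in RHS](card_ord n) -prodr_const.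
  rewrite -(@esum_prod _ _ (fun _ k =>
    Num.sqrt ((\sum_x p x * T k x) * (\sum_x q x * T k x)))) => [|i k|//].
    apply: eq_esum => y _.
    rewrite /P /Q !output_pmfE -big_split/= sqrt_prod// => i.
    have [p0 _] := hp; have [q0 _] := hq.
    by rewrite mulr_ge0// sumr_ge0// => x _; rewrite mulr_ge0//; case: (hT x).
  exact: sqrtr_ge0.
rewrite -minE (esumID [set y | (Q y <= P y) != true]); last first.
  by move=> y _; rewrite lee_fin sqrtr_ge0.
rewrite !setTI wrong_setC; apply: leeD; apply: le_esum => y /=;
  rewrite lee_fin -/(P y) -/(Q y).
- rewrite eqb_id -ltNge => /ltW PQ.
  by rewrite -[leLHS]ger0_norm// -sqrtr_sqr ler_wsqrtr// expr2 ler_wpM2l.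
- rewrite eqb_id => /negP; rewrite negbK => QP.
  by rewrite -[leLHS]ger0_norm// -sqrtr_sqr ler_wsqrtr// expr2 ler_wpM2r.
Qed.

End Distributions.
End Testing.

(** * Reduction to randomized response on a two-point set *)

Section RandomizedResponse.
Variables (R : realType) (X : finType).
Hypothesis X2 : #|X| = 2%N.
Implicit Types (p q : X -> R) (E : R).

Lemma card2_sum : exists a b : X,
  [/\ a != b, forall x, x = a \/ x = b &
      forall f : X -> R, \sum_x f x = f a + f b].
Proof.
have := enum_uniq X; have := mem_enum X.
have : size (enum X) = 2%N by rewrite -cardE.
case eX : (enum X) => [//|a [//|b [|//]]] _ mX /=; rewrite inE andbT => ab.
exists a, b; split => // [x|f].
  by have := mX x; rewrite !inE => /orP[] /eqP; [left|right].
by rewrite -big_enum eX !big_cons big_nil /= addr0.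
Qed.

(* Law of the randomized response that reports its input with probability
   [E / (E + 1)] and the other element with probability [1 / (E + 1)]. *)
Definition rr_law E p (x : X) : R := (1 + (E - 1) * p x) / (E + 1).

(* [rr_post E T] is the channel which, applied to the randomized response,
   gives back [T]; it is nonnegative exactly because [T] is LDP. *)
Definition rr_post E (T : nat -> X -> R) (k : nat) (z : X) : R :=
  ((E + 1) * T k z - \sum_x T k x) / (E - 1).

Lemma rr_law_distribution E p : 1 < E -> is_distribution p ->
  is_distribution (rr_law E p).
Proof.
move=> E1 [p0 p1]; split=> [x|].
  by rewrite divr_ge0// addr_ge0 ?mulr_ge0 ?subr_ge0//; lra.
have [a [b [_ _ S]]] := card2_sum; move: p1; rewrite !S /rr_law => p1.
have -> : p b = 1 - p a by lra.
by field; lra.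
Qed.

Lemma rr_post_channel (eps : R) (T : nat -> X -> R) : 0 < eps ->
  is_channel T -> is_LDP eps T -> is_channel (rr_post (expR eps) T).
Proof.
move=> eps0 hT ldp; have E1 : 1 < expR eps by rewrite expR_gt1.
set E := expR eps in ldp E1 *.
have [a [b [_ ab S]]] := card2_sum.
have K0 k x : 0 <= rr_post E T k x.
  rewrite /rr_post S divr_ge0//; last lra.
  case: (ab x) => ->.
  - by have := ldp b a k; rewrite -/E; lra.
  - by have := ldp a b k; rewrite -/E; lra.
move=> x; split=> [k//|].
have [x' hx'] : exists x', forall k, \sum_z T k z = T k x + T k x'.
  by case: (ab x) => ->; [exists b|exists a] => k; rewrite S// addrC.
have [T0 T1] := hT x; have [T0' T1'] := hT x'.
(* Moving the negative term across leaves only nonnegative sums, so the identity makes sense in the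
   extended reals; it reads [(E - 1) r + 1 = E] for the total mass [r] and also excludes infinite
   [r]. *)
have : (\esum_(k in [set: nat]) ((E - 1) * rr_post E T k x)%:E +
        \esum_(k in [set: nat]) (T k x')%:E =
        \esum_(k in [set: nat]) (E * T k x)%:E)%E.
  rewrite -esumD => [|k _|k _]; last 2 first.
  - by rewrite lee_fin mulr_ge0// subr_ge0 ltW.
  - by rewrite lee_fin.
  apply: eq_esum => k _; rewrite -EFinD; congr (_%:E).
  by rewrite /rr_post hx'; field; lra.
rewrite esumZl ?subr_ge0 ?(ltW E1)// esumZl; last lra.
rewrite T1 T1' mule1.
case: (\esum_(k in _) _)%E => [r|//|//].
- rewrite -EFinM -EFinD => -[Er]; congr (_%:E).
  have : (E - 1) * (r - 1) = 0 by lra.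
  by move/eqP; rewrite mulf_eq0 !subr_eq0 => /orP[/eqP|/eqP//]; lra.
- by rewrite gt0_muley// lte_fin subr_gt0.
- by rewrite gt0_muleNy// lte_fin subr_gt0.
Qed.

(** Randomized response has matrix [[[E, 1], [1, E]] / (E + 1)], and [rr_post] composes [T] with its
    inverse [[[E, -1], [-1, E]] / (E - 1)]. *)
Lemma rr_postE E p (T : nat -> X -> R) k : 1 < E -> is_distribution p ->
  \sum_x p x * T k x = \sum_z rr_law E p z * rr_post E T k z.
Proof.
move=> E1 [_]; have [a [b [_ _ S]]] := card2_sum.
rewrite !S /rr_law /rr_post !S => p1.
have -> : p b = 1 - p a by lra.
by field; apply/andP; split; lra.
Qed.

(** The same outputs arise when the users hold randomized responses and apply [rr_post], so the
    bound for arbitrary channels applies to the response laws. *)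
Lemma testable_dh2_ge (eps : R) p q n : 0 < eps ->
  is_distribution p -> is_distribution q -> testable p q eps n ->
  8 / 10 <= n%:R * dh2 (rr_law (expR eps) p) (rr_law (expR eps) q).
Proof.
move=> eps0 hp hq [T [phi [hT err]]].
have E1 : 1 < expR eps by rewrite expR_gt1.
have probE p' A : is_distribution p' -> output_prob p' T A =
    output_prob (rr_law (expR eps) p') (fun i => rr_post (expR eps) (T i)) A.
  move=> hp'; apply: eq_esum => y _; rewrite !output_pmfE; congr (_%:E).
  by apply: eq_bigr => i _; exact: rr_postE.
rewrite !probE// in err.
apply: error_le_dh2 err; [exact: rr_law_distribution..|move=> i].
by have [] := hT i; exact: rr_post_channel.
Qed.

Lemma esum_support2 (f : nat -> R) : (forall k, 0 <= f k) ->
  (forall k, f k.+2 = 0) ->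
  (\esum_(k in [set: nat]) (f k)%:E = (f 0%N + f 1%N)%:E)%E.
Proof.
move=> f0 f2; rewrite -nneseries_esumT => [|k]; last by rewrite lee_fin.
rewrite (nneseries_split 0 2); last by move=> k _; rewrite lee_fin.
rewrite add0n eseries0 ?adde0; last by move=> [|[|k]]// _ _; rewrite f2.
by rewrite big_mkord !big_ord_recl big_ord0/= adde0.
Qed.

Lemma testable_of_dh2 (eps : R) p q n : 0 < eps ->
  is_distribution p -> is_distribution q ->
  18 <= n%:R * dh2 (rr_law (expR eps) p) (rr_law (expR eps) q) ->
  testable p q eps n.
Proof.
move=> eps0 hp hq Hn; have E1 : 1 < expR eps by rewrite expR_gt1.
set E := expR eps in E1 Hn *.
have hrp := rr_law_distribution E1 hp; have hrq := rr_law_distribution E1 hq.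
have [a [b [ab abX S]]] := card2_sum.
(* Randomized response itself, with the outputs [0] and [1] standing for [a] and [b]. *)
pose T (k : nat) (x : X) : R := match k with
  | 0 => (if x == a then E else 1) / (E + 1)
  | 1 => (if x == a then 1 else E) / (E + 1)
  | _ => 0 end.
have T0 k x : 0 <= T k x.
  by case: k => [|[|k]] //=; case: eqP => _; rewrite divr_ge0//; lra.
have hT : is_channel T.
  move=> x; split=> //; rewrite esum_support2// /T; congr (_%:E).
  by case: eqP => _; field; lra.
have push p' k : is_distribution p' ->
    \sum_x p' x * T k x = match k with 0 => rr_law E p' a
                                   | 1 => rr_law E p' b | _ => 0 end.
  move=> [_]; rewrite !S => p1.
  have ba : (b == a) = false by rewrite eq_sym (negbTE ab).
  have -> : p' b = 1 - p' a by lra.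
  rewrite /rr_law; case: k => [|[|k]] /=; rewrite ?eqxx ?ba; last by ring.
  - by field; lra.
  - have -> : p' b = 1 - p' a by lra.
    by field; lra.
have [|phi err] := @ml_error_le R X n p q T
    (1 - dh2 (rr_law E p) (rr_law E q) / 2) hp hq hT.
  rewrite esum_support2 => [|k|k]; last 2 first.
  - exact: sqrtr_ge0.
  - by rewrite !push// mulr0 sqrtr0.
  by rewrite !push// -sum_sqrt_dh2// S.
exists (fun=> T), phi; split.
  move=> i; split=> // x x' k.
  rewrite -/E; case: k => [|[|k]] /=; last by rewrite mulr0.
  - rewrite mulrA ler_pM2r ?invr_gt0; last lra.
    by case: eqP => _; case: eqP => _; nra.
  - rewrite mulrA ler_pM2r ?invr_gt0; last lra.
    by case: eqP => _; case: eqP => _; nra.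
apply: (le_trans err); rewrite lee_fin.
(* The constant 18 makes [1 + n h / 2] at least 10, hence the error at most 1/10. *)
have := onem_expr_le n (dh2_half_itv hrp hrq).
have := dh2_half_itv hrp hrq.
set h := dh2 _ _ in Hn *; move=> /andP[h0 h1].
have : 0 <= (1 - h / 2) ^+ n by rewrite exprn_ge0// subr_ge0.
move: ((1 - h / 2) ^+ n) => c c0; nra.
Qed.

(* The witness is [u = s (2 - s)] with [s = p a + q a]; randomized response
   multiplies [1 - u] by [((E - 1) / (E + 1)) ^ 2]. *)
Lemma dh2_dTV p q (hp : is_distribution p) (hq : is_distribution q) :
  exists u : R, [/\ dTV p q ^+ 2 <= u <= 1,
    dTV p q ^+ 2 <= u * dh2 p q <= 2 * dTV p q ^+ 2 &
    forall E, 1 < E ->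
      (E - 1) ^+ 2 * dTV p q ^+ 2 <=
      (4 * E + (E - 1) ^+ 2 * u) * dh2 (rr_law E p) (rr_law E q) <=
      2 * ((E - 1) ^+ 2 * dTV p q ^+ 2)].
Proof.
have [a [b [ab abX S]]] := card2_sum.
pose u p q := (p a + q a) * (2 - p a - q a).
have dTVE p' q' : is_distribution p' -> is_distribution q' ->
    dTV p' q' ^+ 2 = (p' a - q' a) ^+ 2.
  move=> [_ +] [_]; rewrite /dTV !S => p1 q1.
  have -> : p' b - q' b = - (p' a - q' a) by lra.
  rewrite normrN -[RHS]real_normK ?num_real//; congr (_ ^+ 2).
  by field.
have bound p' q' : is_distribution p' -> is_distribution q' ->
    (p' a - q' a) ^+ 2 <= u p' q' * dh2 p' q' <= 2 * (p' a - q' a) ^+ 2.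
  move=> [p0 +] [q0]; rewrite /dh2 /u !S => p1 q1.
  have eqp := sqr_sqrtr (p0 a); have eqp' := sqr_sqrtr (p0 b).
  have eqq := sqr_sqrtr (q0 a); have eqq' := sqr_sqrtr (q0 b).
  have := sqrtr_ge0 (p' a); have := sqrtr_ge0 (p' b).
  have := sqrtr_ge0 (q' a); have := sqrtr_ge0 (q' b).
  move: (Num.sqrt (p' a)) (Num.sqrt (p' b)) (Num.sqrt (q' a)) (Num.sqrt (q' b))
    eqp eqp' eqq eqq' => s s' t t' eqp eqp' eqq eqq' t'0 t0 s'0 s0.
  (* Factor out [(x - y) ^ 2] and use [x ^ 2 + y ^ 2 <= (x + y) ^ 2 <= 2 (x ^ 2 + y ^ 2)]. *)
  have half (x y : R) : 0 <= x -> 0 <= y ->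
      (x ^+ 2 - y ^+ 2) ^+ 2 / 2 <= (x ^+ 2 + y ^+ 2) * (x - y) ^+ 2 <=
      (x ^+ 2 - y ^+ 2) ^+ 2.
    move=> x0 y0; rewrite subr_sqr exprMn.
    have := sqr_ge0 (x - y); have := mulr_ge0 x0 y0.
    move=> xy0 d0; apply/andP; split; nra.
  have /andP[l1 r1] := half s t s0 t0; have /andP[l2 r2] := half s' t' s'0 t'0.
  have D' : (s' ^+ 2 - t' ^+ 2) ^+ 2 = (s ^+ 2 - t ^+ 2) ^+ 2.
    have -> : s' ^+ 2 = 1 - s ^+ 2 by lra.
    have -> : t' ^+ 2 = 1 - t ^+ 2 by lra.
    by ring.
  have -> : 2 - p' a - q' a = s' ^+ 2 + t' ^+ 2 by lra.
  rewrite D' in l2 r2; rewrite -eqp -eqq.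
  have g0 : 0 <= s ^+ 2 + t ^+ 2 by rewrite addr_ge0 ?sqr_ge0.
  have g'0 : 0 <= s' ^+ 2 + t' ^+ 2 by rewrite addr_ge0 ?sqr_ge0.
  have gg : s' ^+ 2 + t' ^+ 2 = 2 - (s ^+ 2 + t ^+ 2) by lra.
  move: gg g0 g'0 l1 r1 l2 r2.
  move: (s ^+ 2 + t ^+ 2) (s' ^+ 2 + t' ^+ 2) ((s - t) ^+ 2) ((s' - t') ^+ 2)
    ((s ^+ 2 - t ^+ 2) ^+ 2) => g g' A A' D -> g0 g'0 l1 r1 l2 r2.
  (* Both [g A] and [g' A'] lie in [[D / 2, D]]. Weighting them by [g'] and [g], where [g + g' = 2],
     puts [g g' (A + A')] in [[D, 2 D]]. *)
  have := ler_wpM2l g'0 l1; have := ler_wpM2l g'0 r1.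
  have := ler_wpM2l g0 l2; have := ler_wpM2l g0 r2.
  by move=> *; apply/andP; split; lra.
have [p0 p1] := hp; have [q0 q1] := hq; move: p1 q1; rewrite !S => p1 q1.
exists (u p q); split.
- rewrite dTVE// /u.
  (* [u - dTV ^ 2 = 2 (p a * p b + q a * q b)] and [1 - u = (1 - p a - q a) ^ 2]. *)
  have := mulr_ge0 (p0 a) (p0 b); have := mulr_ge0 (q0 a) (q0 b).
  have -> : p b = 1 - p a by lra.
  have -> : q b = 1 - q a by lra.
  by have := sqr_ge0 (1 - p a - q a); move=> *; apply/andP; split; nra.
- by rewrite dTVE// bound.
- move=> E E1.
  have := bound _ _ (rr_law_distribution E1 hp) (rr_law_distribution E1 hq).
  set h := dh2 _ _.
  have -> : (rr_law E p a - rr_law E q a) ^+ 2 =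
      (E - 1) ^+ 2 * (p a - q a) ^+ 2 / (E + 1) ^+ 2.
    by rewrite /rr_law; field; lra.
  have -> : u (rr_law E p) (rr_law E q) =
      (4 * E + (E - 1) ^+ 2 * u p q) / (E + 1) ^+ 2.
    by rewrite /rr_law /u; field; lra.
  have c0 : 0 < ((E + 1) ^+ 2)^-1 by rewrite invr_gt0 exprn_gt0//; lra.
  by rewrite [_ / _ * h]mulrAC (mulrA 2) !(ler_pM2r c0) dTVE.
Qed.
End RandomizedResponse.

(** * The extended-real rate and sample complexity *)

Section Rate.
Variable R : realType.

(** With the cases moved into the denominator, the three regimes share one real parameter [rho]. *)
Lemma sample_rateE (X : finType) (p q : X -> R) (eps : R) :
  let rho := if eps <= 1 then eps ^+ 2 * dTV p q ^+ 2
    else if expR 1 <= expR eps <= dh2 p q / dTV p q ^+ 2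
    then expR eps * dTV p q ^+ 2 else dh2 p q in
  sample_rate p q eps = (1 / rho%:E)%E.
Proof. by rewrite /sample_rate; case: ifP => // _; case: ifP. Qed.

Lemma sample_complexity_bounds (X : finType) (p q : X -> R)
    (eps c1 c2 rho : R) :
  0 < c1 -> 0 < c2 -> 0 <= rho ->
  (forall n, testable p q eps n -> c1 <= n%:R * rho) ->
  (0 < rho -> exists2 n, testable p q eps n & n%:R * rho <= c2) ->
  (c1%:E * (1 / rho%:E) <= sample_complexity p q eps)%E /\
  (sample_complexity p q eps <= c2%:E * (1 / rho%:E))%E.
Proof.
move=> c10 c20; rewrite le_eqVlt => /predU1P[<-|rho0] lower upper.
  (* If [rho = 0], as for [p = q], then [lower] excludes every [n], and the rate [1 / 0] is also
     infinite. *)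
  have -> : sample_complexity p q eps = +oo%E.
    rewrite /sample_complexity [X in ereal_inf X](_ : _ = set0) ?ereal_inf0//.
    apply/seteqP; split => // x [n /lower + _].
    by rewrite mulr0 leNgt c10.
  by rewrite inver eqxx mul1e !gt0_muley ?lte_fin.
have [n nt nc2] := upper rho0.
rewrite inver gt_eqF// mul1e -!EFinM; split.
  apply: le_ereal_inf_tmp => _ [m mt <-].
  by rewrite lee_fin ler_pdivrMr// lower.
apply: (@le_trans _ _ n%:R%:E); first by apply: ereal_inf_lbound; exists n.
by rewrite lee_fin ler_pdivlMr.
Qed.

Lemma dTV_eq0_dh2 (X : finType) (p q : X -> R) : dTV p q = 0 -> dh2 p q = 0.
Proof.
move/eqP; rewrite mulf_eq0 invr_eq0 pnatr_eq0/= psumr_eq0// => /allP pq.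
apply: big1 => x _; have := pq x (mem_index_enum x).
by rewrite normr_eq0 subr_eq0 => /eqP ->; rewrite subrr expr0n.
Qed.

Lemma expR_sub1_le (x : R) : expR x - 1 <= x * expR x.
Proof.
have := ler_wpM2r (expR_ge0 x) (expR_ge1Dx (- x)).
by rewrite -expRD addNr expR0; lra.
Qed.

(** At [x = 1/2], [expR_sub1_le] gives [exp (1/2) <= 2]; then square. *)
Lemma expR1_le4 : expR 1 <= 4 :> R.
Proof.
have -> : 1 = 2^-1 + 2^-1 :> R by field.
have := expR_sub1_le 2^-1; have := expR_ge0 (2^-1 : R).
by rewrite expRD; move: (expR 2^-1) => e *; nra.
Qed.

End Rate.

(** * Real inequalities for the three regimes *)

Section Regimes.
Variable R : realType.

(** Here [d] is [dTV ^ 2], [h] is [dh2] and [m] the sample size. The first two cases keep only the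
    summand [4 E], bounding [E - 1] by [eps * E] or by [E]; the last keeps [(E - 1) ^ 2 * u] and
    uses [d <= u * h]. *)
Lemma regime_lower (eps d u h E rho m : R) :
  0 < eps -> 1 < E -> E - 1 <= eps * E -> (eps <= 1 -> E <= 4) ->
  0 <= d <= u -> d <= u * h -> 0 <= m ->
  [\/ eps <= 1 /\ rho = eps ^+ 2 * d, rho = E * d | rho = h] ->
  2 / 5 * (4 * E + (E - 1) ^+ 2 * u) <= m * ((E - 1) ^+ 2 * d) ->
  2 / 5 <= m * rho.
Proof.
move=> eps0 E1 EepsE E4 /andP[d0 du] duh m0 rhoE.
have E0 : 0 < E by lra.
have y0 : 0 < (E - 1) ^+ 2 by rewrite exprn_gt0// subr_gt0.
have md0 : 0 <= m * d by exact: mulr_ge0.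
rewrite mulrCA => hm.
have hE : 8 / 5 * E <= (E - 1) ^+ 2 * (m * d).
  by apply: le_trans hm; have := mulr_ge0 (ltW y0) (le_trans d0 du); lra.
case: rhoE => [[eps1 ->]|->|->].
- have yE : (E - 1) ^+ 2 <= (eps * E) ^+ 2 by rewrite ler_sqr ?nnegrE//; lra.
  have := le_trans hE (ler_wpM2r md0 yE).
  have -> : (eps * E) ^+ 2 * (m * d) = (m * (eps ^+ 2 * d) * E) * E by ring.
  rewrite ler_pM2r//.
  have : m * (eps ^+ 2 * d) * E <= m * (eps ^+ 2 * d) * 4.
    by apply: ler_wpM2l (E4 eps1); rewrite mulr_ge0// mulr_ge0// sqr_ge0.
  lra.
- have yE : (E - 1) ^+ 2 <= E ^+ 2 by rewrite ler_sqr ?nnegrE//; lra.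
  have := le_trans hE (ler_wpM2r md0 yE).
  have -> : E ^+ 2 * (m * d) = m * (E * d) * E by ring.
  by rewrite ler_pM2r//; lra.
- have u0 : 0 < u.
    rewrite (lt_le_trans _ du)// lt_neqAle d0 andbT; apply/eqP => dE.
    by move: hE; rewrite -dE !mulr0 leNgt => /negP; apply; lra.
  rewrite -(ler_pM2r u0) -(ler_pM2l y0).
  have := ler_wpM2l (ltW y0) (ler_wpM2l m0 duh); lra.
Qed.

(** Both summands must now be controlled, which is where the order between [E * d] and [h] enters:
    [E * d <= h] yields [u * E <= 2], while [h <= E * d] lets [E * h] be replaced by [E ^ 2 * d]. *)
Lemma regime_upper (eps d u h E rho m : R) :
  0 < eps -> 1 + eps <= E -> (eps <= 1 -> E <= 4) ->
  0 < d -> 0 <= u <= 1 -> 0 <= h -> u * h <= 2 * d ->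
  [\/ eps <= 1 /\ rho = eps ^+ 2 * d,
      [/\ 1 < eps, rho = E * d & E * d <= h] |
      [/\ 1 < eps, rho = h & h <= E * d]] ->
  m * ((E - 1) ^+ 2 * d) <= 19 * (4 * E + (E - 1) ^+ 2 * u) ->
  m * rho <= 400.
Proof.
move=> eps0 epsE E4 d0 /andP[u0 u1] h0 uh rhoE.
have E0 : 0 < E by lra.
have y0 : 0 < (E - 1) ^+ 2 by rewrite exprn_gt0//; lra.
(* For [eps > 1] one has [E >= 2], hence [E <= 2 (E - 1)]. *)
have E2 : 1 < eps -> E ^+ 2 <= 4 * (E - 1) ^+ 2.
  move=> eps1; have -> : 4 * (E - 1) ^+ 2 = (2 * (E - 1)) ^+ 2 by ring.
  by rewrite ler_sqr ?nnegrE//; lra.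
move: y0 E2; have [y yE] : exists y, y = (E - 1) ^+ 2 by eexists.
rewrite -yE => y0 E2 hm; rewrite -(ler_pM2l y0).
case: rhoE => [[eps1 ->]|[eps1 -> Eh]|[eps1 -> hE]].
- have ay : eps ^+ 2 <= y by rewrite yE ler_sqr ?nnegrE//; lra.
  have a0 := sqr_ge0 eps.
  have := ler_wpM2l a0 hm; have := ler_wpM2l a0 (E4 eps1).
  have := ler_wpM2l (mulr_ge0 a0 (ltW y0)) u1.
  have a1 : eps ^+ 2 <= 1 by rewrite expr_le1// ltW.
  have := ler_wpM2l (ltW y0) a1.
  move: (eps ^+ 2) ay a0 a1 => a ay a0 a1 k1 k2 k3 k4.
  have Z : a * (m * (y * d)) <= 304 * a + 19 * y by lra.
  have Z' : y * (m * (a * d)) <= 323 * y by lra.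
  lra.
- have uE : u * E <= 2.
    by rewrite -(ler_pM2r d0) -mulrA (le_trans _ uh)// ler_wpM2l.
  have E4y := E2 eps1.
  have Z : E * (m * (y * d)) <= 76 * E ^+ 2 + 19 * (y * (u * E)).
    by have := ler_wpM2l (ltW E0) hm; lra.
  have yuE : y * (u * E) <= y * 2 by rewrite ler_pM2l.
  have Z' : y * (m * (E * d)) <= 342 * y by lra.
  lra.
- rewrite -(ler_pM2r d0); have E4y := ler_wpM2r (ltW d0) (E2 eps1).
  have Z : h * (m * (y * d)) <= 76 * (E * h) + 19 * (y * (u * h)).
    by have := ler_wpM2l h0 hm; lra.
  have yuh : y * (u * h) <= y * (2 * d) by rewrite ler_pM2l.
  have Eh : E * h <= E * (E * d) by rewrite ler_pM2l.
  have Z' : y * (m * h) * d <= 342 * (y * d) by lra.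
  have := mulr_gt0 y0 d0; lra.
Qed.

End Regimes.

Theorem theorem1p6 (R : realType) :
  exists c1 c2 : R, [/\ 0 < c1, 0 < c2 &
    forall (X : finType) (p q : X -> R) (eps : R),
      #|X| = 2%N -> is_distribution p -> is_distribution q -> 0 < eps ->
      (c1%:E * sample_rate p q eps <= sample_complexity p q eps)%E /\
      (sample_complexity p q eps <= c2%:E * sample_rate p q eps)%E].
Proof.
(* 2/5 is half of the 8/10 in [testable_dh2_ge]; 400 exceeds the constants 323 and 342 reached in
   [regime_upper]. *)
exists (2 / 5), 400; split; [lra|lra|move=> X p q eps X2 hp hq eps0].
have E1 : 1 < expR eps by rewrite expR_gt1.
have lower n := @testable_dh2_ge R X X2 eps p q n eps0 hp hq.
have upper n := @testable_of_dh2 R X X2 eps p q n eps0 hp hq.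
have [u [/andP[du u1] /andP[h1 h2] /(_ _ E1) /andP[H1 H2]]] := dh2_dTV X2 hp hq.
have Eeps := expR_ge1Dx eps; have Eeps' := expR_sub1_le eps.
have E4 : eps <= 1 -> expR eps <= 4.
  by move=> eps1; rewrite (le_trans _ (expR1_le4 R))// ler_expR.
have h0 := dh2_ge0 p q; have d0 := sqr_ge0 (dTV p q).
have hd : 0 = dTV p q ^+ 2 -> dh2 p q = 0.
  by move/esym/eqP; rewrite sqrf_eq0 => /eqP/dTV_eq0_dh2.
(* The quotient [w / v] is the Hellinger term [H] up to a factor 2: [w <= v * H <= 2 * w]. *)
pose w := (expR eps - 1) ^+ 2 * dTV p q ^+ 2.
pose v := 4 * expR eps + (expR eps - 1) ^+ 2 * u.
pose H := dh2 (rr_law (expR eps) p) (rr_law (expR eps) q).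
rewrite -/w -/v -/H in H1 H2.
have v0 : 0 < v.
  have := mulr_ge0 (sqr_ge0 (expR eps - 1)) (le_trans d0 du).
  by have := expR_gt0 eps; rewrite /v; lra.
have lower' n : testable p q eps n -> 2 / 5 * v <= n%:R * w.
  move=> /lower; rewrite -/H => nt; have := ler_wpM2r (ltW v0) nt.
  have := ler_wpM2l (ler0n R n) H2; lra.
have upper' : 0 < dTV p q ^+ 2 ->
    exists2 n, testable p q eps n & n%:R * w <= 19 * v.
  move=> d1; have w0 : 0 < w by rewrite mulr_gt0// exprn_gt0// subr_gt0.
  have wv : w <= v.
    by have := ler_wpM2l (sqr_ge0 (expR eps - 1)) du; rewrite /w /v; lra.
  (* Rounding up gives [n * H >= n * w / v >= 18]; the extra sample costs [w <= v], which turns 18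
     into 19. *)
  exists (Num.truncn (18 * v / w)).+1.
    apply: upper; have := truncnS_gt (18 * v / w).
    rewrite ltr_pdivrMr// => /ltW Nw.
    rewrite -/H -(ler_pM2r v0); apply: le_trans Nw _.
    by rewrite [leRHS]mulrAC -[leRHS]mulrA ler_wpM2l.
  have : (Num.truncn (18 * v / w))%:R <= 18 * v / w.
    rewrite truncn_le//; apply: divr_ge0 (ltW w0); exact: mulr_ge0 (ltW v0).
  by rewrite ler_pdivlMr// -natr1; lra.
rewrite sample_rateE; apply: sample_complexity_bounds; [lra|lra| | |].
- case: ifP => _; first exact: mulr_ge0 (sqr_ge0 _) d0.
  by case: ifP => _ //; rewrite mulr_ge0 ?expR_ge0.
- move=> n /lower'; apply: (@regime_lower _ eps _ _ (dh2 p q)) => //.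
    by rewrite d0.
  case: ifP => e1; first by constructor 1.
  by case: ifP => _; [constructor 2|constructor 3].
(* Each of the three values of [rho] vanishes with [dTV], the value [dh2] by [hd]. *)
- move=> rho0; have d1 : 0 < dTV p q ^+ 2.
    rewrite lt_neqAle d0 andbT; apply/eqP => dE.
    move: rho0; rewrite hd// -dE !mulr0.
    by case: ifP => _; [|case: ifP => _]; rewrite ltxx.
  have [n nt nv] := upper' d1; exists n => //.
  apply: (@regime_upper _ eps _ u (dh2 p q)) nv => //.
    by rewrite u1 (le_trans d0 du).
  case: ifPn => e1; first by constructor 1.
  rewrite -ltNge in e1; case: ifPn => [/andP[_]|].
    by rewrite ler_pdivlMr//; constructor 2.
  rewrite ler_expR (ltW e1)/= -ltNge ltr_pdivrMr// => /ltW; by constructor 3.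
Qed.
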